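(* Let $n\in\mathbb{N}$ and let $\mathcal{T}_n\subseteq M_n$ be the algebra of upper triangular matrices which are constant on the main diagonal. Then every subalgebra of $\mathcal{T}_n$ is hereditarily antisymmetric.
   Context: $M_n=M_n(\mathbb{C})$ is identified with the linear operators on the Hilbert space $\mathbb{C}^n$ with its standard inner product. An operator algebra is a complex linear subspace of operators closed under products (not necessarily unital or self-adjoint); subalgebras are understood in this sense. An operator algebra $\mathcal{B}$ is antisymmetric if $\mathcal{B}\cap\mathcal{B}^*$ is $\{0\}$ or $\mathbb{C}\cdot I$. A subspace $\mathcal{E}$ is invariant for an operator algebra $\mathcal{A}\subseteq M_n$ if $A(\mathcal{E})\subseteq\mathcal{E}$ for all $A\in\mathcal{A}$; it is semi-invariant if $\mathcal{E}=\mathcal{E}_1\cap\mathcal{E}_2^\perp$ for some invariant subspaces $\mathcal{E}_2\subseteq\mathcal{E}_1$. If $P$ is the orthogonal projection onto a semi-invariant subspace $\mathcal{E}$, then $P\mathcal{A}P$, regarded as a subset of $B(\mathcal{E})$, is an operator algebra called a subquotient of $\mathcal{A}$. $\mathcal{A}$ is hereditarily antisymmetric if every subquotient of $\mathcal{A}$ is antisymmetric (as an operator algebra in $B(\mathcal{E})$). *)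

(* Defs.v *)
From HB Require Import structures.
From mathcomp Require Import all_boot all_order all_algebra.
From mathcomp Require Import classical_sets reals complex.

Set Implicit Arguments.
Unset Strict Implicit.
Unset Printing Implicit Defensive.

Import Order.TTheory GRing.Theory Num.Theory Num.Def.
Local Open Scope ring_scope.
Local Open Scope classical_set_scope.

Section InnerProduct.
Variables (C : numClosedFieldType) (n : nat).

(* The library's [dotmx] is only for row vectors; matrices act here on column
   vectors. Linear in the first argument, antilinear in the second. *)
Definition cdot (x y : 'cV[C]_n) : C := \sum_i x i 0 * (y i 0)^*.

Fact cdot_bilinear :
  bilinear_for (GRing.Scale.Law.clone _ _ *%R _)
    (GRing.Scale.Law.clone _ _ (conjC \; *%R) _) cdot.
Proof.
split=> [u | u] k v w /=; rewrite /applyr /cdot mulr_sumr -big_split /=;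
  apply: eq_bigr => i _; rewrite !mxE.
  by rewrite mulrDl mulrA.
by rewrite rmorphD rmorphM mulrDr mulrCA.
Qed.

HB.instance Definition _ := bilinear_isBilinear.Build C _ _ _ _ _ cdot cdot_bilinear.

Fact cdot_hermitian x y : cdot x y = (-1) ^+ false * conjC (cdot y x).
Proof.
rewrite expr0 mul1r /cdot rmorph_sum /=; apply: eq_bigr => i _.
by rewrite rmorphM /= conjCK mulrC.
Qed.

HB.instance Definition _ :=
  isHermitianSesquilinear.Build C _ false conjC cdot cdot_hermitian.

Fact cdot_gt0 x : x != 0 -> 0 < cdot x x.
Proof.
move=> x0; rewrite lt_def sumr_ge0 ?andbT => [|i _]; last exact: mul_conjC_ge0.
apply: contraNneq x0; rewrite /cdot => /eqP.
rewrite psumr_eq0 => [/allP xi0|i _]; last exact: mul_conjC_ge0.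
apply/eqP/colP => i; rewrite mxE; apply/eqP.
by have := xi0 i (mem_index_enum _); rewrite mul_conjC_eq0.
Qed.

HB.instance Definition _ := isDotProduct.Build C _ cdot cdot_gt0.

End InnerProduct.

Section SubspaceInnerProduct.
Variables (C : numClosedFieldType) (n : nat) (E : {vspace 'cV[C]_n}).

Definition subdot (x y : subvs_of E) : C := cdot (vsval x) (vsval y).

Fact subdot_bilinear :
  bilinear_for (GRing.Scale.Law.clone _ _ *%R _)
    (GRing.Scale.Law.clone _ _ (conjC \; *%R) _) subdot.
Proof.
split=> [u | u] k v w /=; rewrite /applyr /subdot linearP.
  by rewrite linearPl.
by rewrite linearPr.
Qed.

HB.instance Definition _ :=
  bilinear_isBilinear.Build C _ _ _ _ _ subdot subdot_bilinear.

Fact subdot_hermitian x y : subdot x y = (-1) ^+ false * conjC (subdot y x).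
Proof. exact: cdot_hermitian. Qed.

HB.instance Definition _ :=
  isHermitianSesquilinear.Build C _ false conjC subdot subdot_hermitian.

Fact subdot_gt0 x : x != 0 -> 0 < subdot x x.
Proof. by move=> x0; apply: cdot_gt0. Qed.

HB.instance Definition _ := isDotProduct.Build C _ subdot subdot_gt0.

End SubspaceInnerProduct.

Section Antisymmetric.
Variables (C : numClosedFieldType) (H : vectType C) (dot : {dot H for conjC}).

Definition is_adjoint (T S : 'End(H)) : Prop :=
  forall x y, dot (T x) y = dot x (S y).

Definition adjoint_set (B : set 'End(H)) : set 'End(H) :=
  [set S | exists2 T, B T & is_adjoint T S].

Definition antisymmetric_algebra (B : set 'End(H)) : Prop :=
  B `&` adjoint_set B = [set 0] \/
  B `&` adjoint_set B = range (fun c : C => c *: \1%VF).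

End Antisymmetric.

Section OperatorAlgebras.
Variables (C : numClosedFieldType) (n : nat).
Implicit Types (A : {vspace 'M[C]_n}) (E : {vspace 'cV[C]_n}).

Definition operator_algebra A : Prop :=
  {in A &, forall X Y : 'M[C]_n, X *m Y \in A}.

Definition invariant A E : Prop :=
  {in A & E, forall (X : 'M[C]_n) (x : 'cV[C]_n), X *m x \in E}.

Definition semi_invariant A E : Prop :=
  exists E1 E2, [/\ invariant A E1, invariant A E2, (E2 <= E1)%VS
    & E = (E1 :&: orthov (@cdot C n) E2)%VS].

(* [daddv_pi U V] is the projection onto U along V only when U and V intersect
   trivially; [orthoproj_mem] and [orthoproj_orth] below characterize the
   result. *)
Definition orthoproj E : 'End('cV[C]_n) := daddv_pi E (orthov (@cdot C n) E).

Lemma orthoproj_cap E : (E :&: orthov (@cdot C n) E = 0)%VS.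
Proof.
apply/eqP; rewrite -subv0; apply/subvP => x /memv_capP[xE /mem_orthovP/(_ _ xE)].
by move/eqP; rewrite dnorm_eq0 memv0.
Qed.

Definition dot_coords E (x : 'cV[C]_n) : 'rV[C]_(\dim E) :=
  \row_i cdot x (vbasis E)`_i.

Fact dot_coords_linear E : linear (dot_coords E).
Proof. by move=> k x y; apply/rowP => i; rewrite !mxE linearPl. Qed.

HB.instance Definition _ E :=
  GRing.isLinear.Build C _ _ _ (dot_coords E) (dot_coords_linear E).

Lemma orthoproj_add E : (E + orthov (@cdot C n) E = fullv)%VS.
Proof.
set f := linfun (dot_coords E).
have kerf : (lker f <= orthov (@cdot C n) E)%VS.
  apply/subvP => x; rewrite memv_ker lfunE /= => /eqP/rowP fx0.
  apply/mem_orthovP => y /coord_vbasis->; rewrite linear_sumr big1 // => i _.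
  by have := fx0 i; rewrite linearZr !mxE /= => ->; rewrite mulr0.
have fE : (f @: E = fullv)%VS.
  apply/eqP; rewrite eqEdim subvf dimvf /dim /= mul1n -{1}(limg_ker_dim f E).
  suff -> : (E :&: lker f = 0)%VS by rewrite dimv0 add0n.
  by apply/eqP; rewrite -subv0 -(orthoproj_cap E) capvS.
apply/eqP; rewrite eqEsubv subvf; apply/subvP => x _.
have /memv_imgP[y yE fxy] : f x \in (f @: E)%VS by rewrite fE memvf.
rewrite -(subrKC y x) memv_add //; apply: (subvP kerf).
by rewrite memv_ker linearB /= fxy subrr.
Qed.

Lemma orthoproj_mem E x : orthoproj E x \in E.
Proof. exact: memv_pi. Qed.

Lemma orthoproj_orth E x : x - orthoproj E x \in orthov (@cdot C n) E.
Proof.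
have xE : x \in (E + orthov (@cdot C n) E)%VS by rewrite orthoproj_add memvf.
rewrite -{1}(daddv_pi_add (orthoproj_cap E) xE) addrAC subrr add0r.
exact: memv_pi.
Qed.

(* PXP as an operator on E: [vsval] is the inclusion of E in C^n, and [vsproj E]
   retypes a vector of E as an element of [subvs_of E]. *)
Definition compression E (X : 'M[C]_n) : 'End(subvs_of E) :=
  (linfun (vsproj E) \o orthoproj E \o linfun (mulmx X) \o orthoproj E
   \o linfun vsval)%VF.

Lemma compressionE E X x :
  vsval (@compression E X x) = orthoproj E (X *m vsval x).
Proof.
rewrite /compression !comp_lfunE !lfunE /= vsprojK ?orthoproj_mem //.
congr (orthoproj E (X *m _)).
exact: daddv_pi_id (orthoproj_cap E) (subvsP x).
Qed.

Definition subquotient A E : set 'End(subvs_of E) :=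
  @compression E @` [set` A].

Definition hereditarily_antisymmetric A : Prop :=
  forall E, semi_invariant A E ->
    antisymmetric_algebra (@subdot C n E) (@subquotient A E).

Definition upper_const_diag : {pred 'M[C]_n} :=
  [pred X : 'M[C]_n |
    [forall i : 'I_n, forall j : 'I_n, (j < i)%N ==> (X i j == 0)] &&
    [forall i, forall j, X i i == X j j]].

End OperatorAlgebras.

(* Main.v *)
(** If [S] lies in [B `&` B^*], then [S] and its adjoint are compressions of
    [c + N] and [conj c + K] with [N] strictly upper triangular and [K] upper
    triangular. Compression to a semi-invariant subspace is multiplicative on
    matrices preserving the two invariant subspaces, so with [Z = S - c] the
    operator [Z^* Z] is the compression of [K N], which is strictly upper
    triangular. Thus [Z^* Z] is nilpotent and self-adjoint, hence zero, and
    [S = c]. *)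

Require Import Defs.
From mathcomp Require Import all_boot all_order all_algebra.
From mathcomp Require Import classical_sets reals complex.
Local Open Scope ring_scope.

Set Implicit Arguments.
Unset Strict Implicit.
Unset Printing Implicit Defensive.

Import GRing.Theory Num.Theory.

(** Stated for one matrix, since the shift [X - c%:M] may leave an algebra that lacks the
    identity. *)
Definition mx_preserves (F : fieldType) n (X : 'M[F]_n) (E : {vspace 'cV[F]_n}) :=
  {in E, forall x : 'cV[F]_n, X *m x \in E}.

Definition strict_upper (F : fieldType) n (X : 'M[F]_n) :=
  forall i j : 'I_n, (j <= i)%N -> X i j = 0.

Section TriangularMatrices.
Variables (F : fieldType) (n : nat).
Implicit Types (X Y : 'M[F]_n) (E : {vspace 'cV[F]_n}).

Lemma mx_preservesB X (c : F) E :
  mx_preserves X E -> mx_preserves (X - c%:M) E.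
Proof.
by move=> XE x xE; rewrite mulmxBl mul_scalar_mx rpredB ?rpredZ ?XE.
Qed.

Lemma strict_upper_mulmx X Y :
  (forall i j : 'I_n, (j < i)%N -> X i j = 0) -> strict_upper Y ->
  strict_upper (X *m Y).
Proof.
move=> Xup Yup i j ji; rewrite mxE big1 // => k _.
have [ki|ik] := ltnP k i; first by rewrite Xup ?mul0r.
by rewrite Yup ?mulr0 // (leq_trans ji).
Qed.

(** Each multiplication by [X] clears one more coordinate, starting from the last, so [n] of them
    clear the vector. *)
Lemma strict_upper_nilpotent X (x : 'cV[F]_n) :
  strict_upper X -> iter n (mulmx X) x = 0.
Proof.
move=> Xup.
have vanish k (i : 'I_n) : (n <= i + k)%N -> iter k (mulmx X) x i 0 = 0.
  elim: k i => [|k IHk] i; first by rewrite addn0 leqNgt ltn_ord.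
  move=> ni; rewrite iterS mxE big1 // => j _.
  have [ji|ij] := leqP j i; first by rewrite Xup ?mul0r.
  by rewrite IHk ?mulr0 // (leq_trans ni) // addnS -addSn leq_add2r.
by apply/colP => i; rewrite mxE vanish // leq_addl.
Qed.

End TriangularMatrices.

Lemma upper_const_diagP (C : numClosedFieldType) n (X : 'M[C]_n) :
  X \in @upper_const_diag C n ->
  (forall i j : 'I_n, (j < i)%N -> X i j = 0) /\
  exists c, strict_upper (X - c%:M).
Proof.
case/andP => /forallP/(_ _)/forallP Xup /forallP/(_ _)/forallP Xdiag.
have Xup0 (i j : 'I_n) : (j < i)%N -> X i j = 0.
  by move=> ji; apply/eqP; apply: (implyP (Xup i j)).
(* An empty matrix has no diagonal entry to supply [c], so 0 is taken there; otherwise [c] is the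
   first diagonal entry. *)
split=> //; case: n => [|n] in X Xup Xdiag Xup0 *; first by exists 0 => -[].
exists (X ord0 ord0) => i j; rewrite !mxE leq_eqVlt => /orP[/eqP/val_inj->|ji].
  by rewrite eqxx (eqP (Xdiag i ord0)) subrr.
by rewrite (Xup0 i j ji) -val_eqE gtn_eqF // subrr.
Qed.

Section SelfAdjoint.
Variables (C : numClosedFieldType) (H : vectType C).
Variable (dot : {dot H for Num.Def.conjC}).

(** If [T (T y) = 0], then <Ty, Ty> = <y, TTy> = 0, so [T y = 0]; the exponent thus descends to
    1. *)
Lemma nilpotent_self_adjoint (T : 'End(H)) k x :
  is_adjoint dot T T -> iter k T x = 0 -> T x = 0.
Proof.
move=> Tsa; elim: k => [/= ->|[//|k] IHk /= TT0]; first exact: linear0.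
by apply: IHk; apply/eqP; rewrite -(dnorm_eq0 dot) Tsa TT0 linear0r.
Qed.

End SelfAdjoint.

Section Compression.
Variables (C : numClosedFieldType) (n : nat).
Implicit Types (X Y : 'M[C]_n) (E : {vspace 'cV[C]_n}).

Lemma orthoproj_id E x : x \in E -> orthoproj E x = x.
Proof. exact: daddv_pi_id (orthoproj_cap E). Qed.

Lemma orthoproj0 E x : x \in orthov (@cdot C n) E -> orthoproj E x = 0.
Proof.
move=> xE; apply/eqP; rewrite -memv0 -(orthoproj_cap E) memv_cap orthoproj_mem.
by rewrite -[orthoproj E x](subKr x) rpredB // orthoproj_orth.
Qed.

Lemma compressionB E X (c : C) :
  compression E (X - c%:M) = compression E X - c *: \1%VF.
Proof.
apply/lfunP => x; apply: subvs_inj.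
rewrite add_lfunE opp_lfunE scale_lfunE id_lfunE linearB linearZ /= !compressionE.
rewrite mulmxBl mul_scalar_mx linearB linearZ /=.
by rewrite (orthoproj_id (subvsP x)) scalerN.
Qed.

Lemma compressionZ E X (c : C) :
  compression E (c *: X) = c *: compression E X.
Proof.
apply/lfunP => x; apply: subvs_inj.
by rewrite scale_lfunE linearZ /= !compressionE -scalemxAl linearZ.
Qed.

Lemma compression0 E : compression E 0 = 0.
Proof. by rewrite -(scale0r (0 : 'M[C]_n)) compressionZ scale0r. Qed.

(** The component [q] of [x] orthogonal to [E2] lies in [E], hence is orthogonal to both [x] and
    [x - q], that is, to itself. *)
Lemma semi_invariant_orth E1 E2 E x :
  (E2 <= E1)%VS -> E = (E1 :&: orthov (@cdot C n) E2)%VS ->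
  x \in E1 -> x \in orthov (@cdot C n) E -> x \in E2.
Proof.
move=> sE21 defE xE1 /mem_orthovP xE.
have pE2 := orthoproj_mem E2 x; have qE2 := orthoproj_orth E2 x.
set q := x - orthoproj E2 x in qE2.
have qE : q \in E by rewrite defE memv_cap qE2 rpredB // (subvP sE21).
suff q0 : q = 0 by rewrite (subr0_eq q0).
apply/eqP; rewrite -(dnorm_eq0 (@cdot C n)) {1}/q linearBl /= xE // sub0r.
by rewrite hermC (mem_orthovP qE2) // rmorph0 mulr0 oppr0.
Qed.

(** The error [x - orthoproj E x] lies in [E2]; [X] keeps it there, and the projection onto [E]
    kills [E2]. *)
Lemma orthoproj_mulmx E1 E2 E X x :
  (E2 <= E1)%VS -> E = (E1 :&: orthov (@cdot C n) E2)%VS ->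
  mx_preserves X E2 -> x \in E1 ->
  orthoproj E (X *m orthoproj E x) = orthoproj E (X *m x).
Proof.
move=> sE21 defE XE2 xE1.
have sEE1 : (E <= E1)%VS by rewrite defE capvSl.
apply/esym/eqP; rewrite -subr_eq0 -linearB -mulmxBr; apply/eqP/orthoproj0.
have /XE2 : x - orthoproj E x \in E2.
  apply: semi_invariant_orth sE21 defE _ (orthoproj_orth E x).
  by rewrite rpredB // (subvP sEE1) ?orthoproj_mem.
move=> yE2; apply/mem_orthovP => v.
rewrite {1}defE => /memv_capP[_ /mem_orthovP vE2].
by rewrite hermC vE2 // rmorph0 mulr0.
Qed.

Lemma compressionM E1 E2 E X Y :
  (E2 <= E1)%VS -> E = (E1 :&: orthov (@cdot C n) E2)%VS ->
  mx_preserves X E2 -> mx_preserves Y E1 ->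
  compression E (X *m Y) = (compression E X \o compression E Y)%VF.
Proof.
move=> sE21 defE XE2 YE1; apply/lfunP => x; apply: subvs_inj.
rewrite comp_lfunE !compressionE (orthoproj_mulmx sE21 defE) ?mulmxA //.
by apply: YE1; apply: subvP (subvsP x); rewrite defE capvSl.
Qed.

Lemma iter_compression E1 E2 E X k x :
  (E2 <= E1)%VS -> E = (E1 :&: orthov (@cdot C n) E2)%VS ->
  mx_preserves X E1 -> mx_preserves X E2 ->
  vsval (iter k (compression E X) x) = orthoproj E (iter k (mulmx X) (vsval x)).
Proof.
move=> sE21 defE XE1 XE2.
have xE1 : vsval x \in E1.
  by apply: subvP (subvsP x); rewrite defE capvSl.
have XkE1 m : iter m (mulmx X) (vsval x) \in E1 by elim: m => // m; apply: XE1.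
elim: k => [|k IHk] /=; first by rewrite orthoproj_id ?subvsP.
by rewrite compressionE IHk (orthoproj_mulmx sE21 defE).
Qed.

Lemma compression_strict_upper_nilpotent E1 E2 E X x :
  (E2 <= E1)%VS -> E = (E1 :&: orthov (@cdot C n) E2)%VS ->
  mx_preserves X E1 -> mx_preserves X E2 -> strict_upper X ->
  iter n (compression E X) x = 0.
Proof.
move=> sE21 defE XE1 XE2 Xup; apply: subvs_inj.
by rewrite (iter_compression _ _ sE21 defE) // strict_upper_nilpotent ?linear0.
Qed.

Lemma adjoint_compression_scalar E1 E2 E X Y :
  (E2 <= E1)%VS -> E = (E1 :&: orthov (@cdot C n) E2)%VS ->
  mx_preserves X E1 -> mx_preserves X E2 ->
  mx_preserves Y E1 -> mx_preserves Y E2 ->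
  X \in @upper_const_diag C n -> Y \in @upper_const_diag C n ->
  is_adjoint (@subdot C n E) (compression E X) (compression E Y) ->
  exists c, compression E Y = c *: \1%VF.
Proof.
move=> sE21 defE XE1 XE2 YE1 YE2 /upper_const_diagP[Xup _].
move=> /upper_const_diagP[_ [c Yc]] adjXY; exists c.
pose K := X - (c^*)%:M; pose N := Y - c%:M.
have adjKN : is_adjoint (@subdot C n E) (compression E K) (compression E N).
  move=> u v; rewrite !compressionB !add_lfunE !opp_lfunE !scale_lfunE !id_lfunE.
  by rewrite linearBl linearBr /= linearZl_LR linearZr /= adjXY.
(* The diagonal of [X] has not been compared with [c^*], so [K] may have a nonzero diagonal;
   strictness of [K *m N] comes from [N]. *)
have Kup (i j : 'I_n) : (j < i)%N -> K i j = 0.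
  by move=> ji; rewrite !mxE (Xup i j ji) -val_eqE gtn_eqF // subrr.
have KNE E' : mx_preserves X E' -> mx_preserves Y E' -> mx_preserves (K *m N) E'.
  by move=> XE' YE' x xE'; rewrite -mulmxA !mx_preservesB.
have KN_M : compression E (K *m N) = (compression E K \o compression E N)%VF.
  by apply: compressionM sE21 defE _ _; apply: mx_preservesB.
have KNsa : is_adjoint (@subdot C n E)
    (compression E (K *m N)) (compression E (K *m N)).
  (* With Z the compression of [N], both sides equal <Zu, Zv>. *)
  move=> u v; rewrite KN_M !(comp_lfunE (compression E K)) adjKN.
  by rewrite [RHS](hermC (@subdot C n E)) /= adjKN [LHS](hermC (@subdot C n E)).
apply/eqP; rewrite -subr_eq0 -compressionB; apply/eqP/lfunP => x.
(* Since <Zx, Zx> = <Z^*Zx, x>, it suffices that Z^*Z, the compression of [K *m N], vanishes at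
   [x]. *)
apply/eqP; rewrite zero_lfunE -(dnorm_eq0 (@subdot C n E)) -adjKN.
rewrite -(comp_lfunE (compression E K)) -KN_M.
rewrite (nilpotent_self_adjoint (k := n) KNsa) ?linear0l //.
apply: (compression_strict_upper_nilpotent _ sE21 defE); [exact: KNE..|].
exact: strict_upper_mulmx Kup Yc.
Qed.

End Compression.

Section ScalarAlgebras.
Variables (C : numClosedFieldType) (H : vectType C).
Variable (dot : {dot H for Num.Def.conjC}).
Local Open Scope classical_set_scope.

(** The two alternatives correspond to whether [B] contains the identity: if so, every scalar and
    its adjoint lie in [B]; if not, rescaling a nonzero scalar of [B] would produce the identity. *)
Lemma antisymmetric_algebra_scalar (B : set 'End(H)) :
  B 0 -> (forall c T, B T -> B (c *: T)) ->
  (forall S, (B `&` adjoint_set dot B) S -> exists c : C, S = c *: \1%VF) ->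
  antisymmetric_algebra dot B.
Proof.
move=> B0 BZ Bscal.
have [B1|nB1] := boolp.pselect (B \1%VF).
  right; apply/seteqP; split=> [S /Bscal[c ->]|_ [c _ <-]]; first by exists c.
  split; first exact: BZ.
  exists (c^* *: \1%VF); first exact: BZ.
  by move=> x y; rewrite !scale_lfunE !id_lfunE linearZl_LR linearZr.
left; apply/seteqP; split=> [S BS|_ ->].
  have [c defS] := Bscal S BS; case: BS => BS _.
  have [c0|c0] := eqVneq c 0; first by rewrite defS c0 scale0r.
  by case: nB1; rewrite -[\1%VF](scalerK c0) -defS; apply: BZ.
split=> //; exists 0 => // x y.
by rewrite !zero_lfunE linear0l linear0r.
Qed.

End ScalarAlgebras.

Theorem corollary4p4 (R : realType) (n : nat) (A : {vspace 'M[R[i]]_n}) :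
  operator_algebra A ->
  {subset A <= @upper_const_diag R[i] n} ->
  hereditarily_antisymmetric A.
Proof.
move=> _ Aup E [E1 [E2 [AE1 AE2 sE21 defE]]].
apply: antisymmetric_algebra_scalar => [|c _ [X AX <-]|S].
- by exists 0; [exact: mem0v | exact: compression0].
- by exists (c *: X); [exact: rpredZ | exact: compressionZ].
(* [S] is the compression of [Y], and the operator in the subquotient whose adjoint is [S] is the
   compression of [X]; both matrices lie in [A]. *)
move=> [[Y AY <-] [_ [X AX <-] adjXY]].
by apply: (adjoint_compression_scalar sE21 defE _ _ _ _ _ _ adjXY);
  [move=> x; exact: AE1 | move=> x; exact: AE2 | move=> x; exact: AE1
  | move=> x; exact: AE2 | exact: Aup | exact: Aup].
Qed.
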